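(* Let $\varphi:\mathbb{R}^n\to\mathbb{R}\cup\{+\infty\}$ be a proper, lower semicontinuous, coercive function that is uniformly quasiconvex with modulus $\phi$ on a nonempty closed convex set $C\subseteq\operatorname{dom}\varphi$. Let $p>1$ and let $\{x^k\}_{k\ge0}$ be a sequence generated by HiPPA with order $p$ and parameters $\gamma_k\in(\gamma_{\min},\gamma_{\max})$. Then, for every tolerance $\varepsilon>0$, at most $$\frac{p\,\gamma_{\max}\left(\varphi(x^0)-\inf_{x\in C}\varphi(x)\right)}{\varepsilon^p}$$ iterations are needed to satisfy the stopping criterion $\|x^{k+1}-x^k\|\le\varepsilon$; that is, the smallest index $k\ge0$ with $\|x^{k+1}-x^k\|\le\varepsilon$ exists and satisfies $$k\le\frac{p\,\gamma_{\max}\left(\varphi(x^0)-\inf_{x\in C}\varphi(x)\right)}{\varepsilon^p}.$$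
   Context: $\|\cdot\|$ is the Euclidean norm on $\mathbb{R}^n$; $\operatorname{dom}\varphi=\{x:\varphi(x)<+\infty\}$; $\varphi$ is proper if $\operatorname{dom}\varphi\ne\emptyset$, and coercive if $\varphi(x)\to+\infty$ as $\|x\|\to+\infty$. A modulus is an increasing function $\phi:[0,+\infty)\to[0,+\infty]$ (i.e. $s\le t$ implies $\phi(s)\le\phi(t)$) that vanishes only at $0$. The function $\varphi$ is uniformly quasiconvex with modulus $\phi$ on a convex set $C\subseteq\operatorname{dom}\varphi$ if for all $x,y\in C$ and $\lambda\in[0,1]$, $$\varphi(\lambda x+(1-\lambda)y)+\lambda(1-\lambda)\phi(\|x-y\|)\le\max\{\varphi(x),\varphi(y)\}.$$ HiPPA (high-order proximal-point algorithm) of order $p>1$: fix $\gamma_{\max}>\gamma_{\min}>0$ and $x^0\in C$; for each $k\ge 0$ choose $\gamma_k\in(\gamma_{\min},\gamma_{\max})$ and choose $$x^{k+1}\in\arg\min_{y\in C}\left(\varphi(y)+\frac{1}{p\gamma_k}\|x^k-y\|^p\right).$$ *)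

(* Defs.v *)
From HB Require Import structures.
From mathcomp Require Import all_boot all_order all_algebra.
From mathcomp Require Import all_classical all_reals all_analysis.

Set Implicit Arguments.
Unset Strict Implicit.
Unset Printing Implicit Defensive.

Import Order.TTheory GRing.Theory Num.Theory.
Import numFieldNormedType.Exports.

Local Open Scope classical_set_scope.
Local Open Scope ring_scope.

(* The library's canonical norm on ['rV[R]_n] is the sup norm; it induces the
   same topology, but the statement needs the Euclidean norm itself. *)
Definition enorm (R : realType) (n : nat) (x : 'rV[R]_n) : R :=
  Num.sqrt (\sum_(i < n) x ord0 i ^+ 2).

Section Functions.
Context {R : realType} {n : nat}.
Implicit Types (f : 'rV[R]_n -> \bar R) (C : set 'rV[R]_n) (phi : R -> \bar R).
Local Open Scope ereal_scope.

Definition effective_dom f : set 'rV[R]_n := [set x | f x < +oo].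

Definition proper_efun f := effective_dom f !=set0.

Definition coercive_efun f :=
  forall A : R, exists M : R, forall x, (M <= enorm x)%R -> A%:E <= f x.

(* A function [0, +oo) -> [0, +oo] is encoded as a function on R of which only
   the values at nonnegative arguments matter. *)
Definition modulus phi :=
  [/\ forall t : R, (0 <= t)%R -> 0 <= phi t,
      forall s t : R, (0 <= s)%R -> (s <= t)%R -> phi s <= phi t
    & forall t : R, (0 <= t)%R -> (phi t = 0 <-> t = 0%R)].

(* When l is 0 or 1 and phi is +oo, the product is 0 * +oo = 0. *)
Definition uniformly_quasiconvex f phi C :=
  forall (x y : 'rV[R]_n) (l : R), C x -> C y -> (0 <= l <= 1)%R ->
    f (l *: x + (1 - l) *: y)%R + (l * (1 - l))%:E * phi (enorm (x - y)%R)
      <= Order.max (f x) (f y).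

Definition argmin_on (g : 'rV[R]_n -> \bar R) C : set 'rV[R]_n :=
  [set y | C y /\ forall z, C z -> g y <= g z].

Definition hippa f C (p gmin gmax : R) (gamma : nat -> R)
    (x : nat -> 'rV[R]_n) :=
  [/\ C (x 0%N),
      forall k, (gmin < gamma k < gmax)%R
    & forall k, argmin_on
        (fun y => f y + ((p * gamma k)^-1 * enorm (x k - y) `^ p)%:E) C
        (x k.+1)].

End Functions.

(* Main.v *)
Require Import Defs.
From HB Require Import structures.
From mathcomp Require Import all_boot all_order all_algebra.
From mathcomp Require Import all_classical all_reals all_analysis.
From mathcomp Require Import lra.
Import Order.TTheory GRing.Theory Num.Theory.
Import numFieldNormedType.Exports.
Local Open Scope classical_set_scope.
Local Open Scope ring_scope.

(* Comparing the minimizer x^{k+1} with the competitor x^k shows that each step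
   decreases f by at least |x^{k+1} - x^k|^p / (p gmax); telescoping, the number
   of steps longer than eps is controlled by the total decrease of f, provided
   f is bounded below on C.  That bound follows from coercivity far away, and
   from the minimality of x^1 on bounded sets. *)

Section EuclideanNorm.
Context {R : realType} {n : nat}.
Implicit Types x y : 'rV[R]_n.

Lemma enorm_ge0 x : 0 <= enorm x.
Proof. exact: sqrtr_ge0. Qed.

Lemma enorm0 : enorm (0 : 'rV[R]_n) = 0.
Proof.
by rewrite /enorm big1 ?sqrtr0// => i _; rewrite mxE expr0n.
Qed.

Lemma enormBC x y : enorm (x - y) = enorm (y - x).
Proof.
by congr Num.sqrt; apply: eq_bigr => i _; rewrite !mxE -sqrrN opprB.
Qed.

Lemma sqr_enorm x : enorm x ^+ 2 = \sum_(i < n) x ord0 i ^+ 2.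
Proof. by rewrite sqr_sqrtr// sumr_ge0// => i _; exact: sqr_ge0. Qed.

(* The crude factor 2 makes Cauchy-Schwarz unnecessary. *)
Lemma enormB_le x y : enorm (x - y) <= 2 * (enorm x + enorm y).
Proof.
have x0 := enorm_ge0 x; have y0 := enorm_ge0 y.
have sqrB : enorm (x - y) ^+ 2 <= 2 * (enorm x ^+ 2 + enorm y ^+ 2).
  rewrite !sqr_enorm -big_split mulr_sumr; apply: ler_sum => i _.
  (* Coordinatewise, [2 * (a ^+ 2 + b ^+ 2) - (a - b) ^+ 2] is the square of [a + b]. *)
  by have := sqr_ge0 (x ord0 i + y ord0 i); rewrite !mxE /=; nra.
rewrite -ler_sqr ?nnegrE ?enorm_ge0//; last by lra.
have xy0 : 0 <= enorm x * enorm y by exact: mulr_ge0.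
by apply: (le_trans sqrB); nra.
Qed.

End EuclideanNorm.

Section Descent.
Context {R : realType} {F d : nat -> R} {eps : R}.
Hypothesis descent : forall k, F k.+1 + d k <= F k.

(** Telescoping. Here [eps] is a threshold on the decrease [d]; the theorem instantiates it with its
    own tolerance raised to the power [p], over [p * gmax]. *)
Lemma descent_count k :
  (forall j, (j < k)%N -> eps <= d j) -> k%:R * eps <= F 0%N - F k.
Proof.
elim: k => [_|k IHk dk]; first by rewrite mul0r subrr.
have := IHk (fun j jk => dk j (ltnW jk)).
have := dk k (ltnSn k); have := descent k.
by rewrite -natr1 mulrDl mul1r; lra.
Qed.

(** Archimedean argument: if every step cost at least [eps], more than [(F 0 - m) / eps] of them
    would push [F] below [m]. *)
Lemma descent_small_step (m : R) :
  (forall k, m <= F k) -> 0 < eps -> exists k, d k < eps.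
Proof.
move=> mF eps0; apply: contrapT => no_small.
have d_large j : eps <= d j.
  by rewrite leNgt; apply/negP => dj; apply: no_small; exists j.
have F0m : 0 <= (F 0%N - m) / eps by rewrite divr_ge0 ?subr_ge0 ?(ltW eps0).
have := archi_boundP F0m; set k := Num.bound _ => k_large.
have count := descent_count k (fun j _ => d_large j).
have : k%:R * eps < k%:R * eps.
  by have := mF k; move: k_large; rewrite ltr_pdivrMr//; lra.
by rewrite ltxx.
Qed.

End Descent.

Section Hippa.
Context {R : realType} {n : nat}.
Context {f : 'rV[R]_n -> \bar R} {C : set 'rV[R]_n} {p gmin gmax : R}.
Context {gamma : nat -> R} {x : nat -> 'rV[R]_n}.
Hypothesis f_notNy : forall y, f y <> -oo%E.
Hypothesis C_dom : C `<=` effective_dom f.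
Hypothesis p_gt0 : 0 < p.
Hypothesis gmin_gt0 : 0 < gmin.
Hypothesis x_hippa : hippa f C p gmin gmax gamma x.

Lemma hippa_mem k : C (x k).
Proof. by case: x_hippa => C0 _ xarg; case: k => // k; case: (xarg k). Qed.

Lemma dom_fin_num y : C y -> f y \is a fin_num.
Proof.
move=> Cy; have := C_dom _ Cy; have := f_notNy y.
by rewrite /effective_dom /=; case: (f y).
Qed.

Lemma hippa_min k y : C y ->
  fine (f (x k.+1)) + (p * gamma k)^-1 * enorm (x k - x k.+1) `^ p
  <= fine (f y) + (p * gamma k)^-1 * enorm (x k - y) `^ p.
Proof.
move=> Cy; case: x_hippa => _ _ /(_ k)[_ /(_ _ Cy)].
by rewrite -(fineK (dom_fin_num _ Cy)) -(fineK (dom_fin_num _ (hippa_mem _))).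
Qed.

Lemma hippa_descent k :
  fine (f (x k.+1)) + (p * gmax)^-1 * enorm (x k.+1 - x k) `^ p
  <= fine (f (x k)).
Proof.
have := hippa_min k _ (hippa_mem k).
(* The competitor's penalty is a power of 0, which vanishes because [p] is nonzero ([powR] sends 0
   to 1 at exponent 0). *)
rewrite subrr enorm0 powR0 ?gt_eqF// mulr0 addr0; apply: le_trans.
rewrite lerD2l enormBC ler_wpM2r ?powR_ge0//.
case: x_hippa => _ /(_ k)/andP[gmin_k k_gmax] _.
have gk0 := lt_trans gmin_gt0 gmin_k; have gmax0 := lt_trans gk0 k_gmax.
rewrite lef_pV2 ?posrE ?mulr_gt0//.
by rewrite ler_pM2l// ltW.
Qed.

Lemma hippa_lower_bounded : coercive_efun f ->
  exists m : R, forall y, C y -> (m%:E <= f y)%E.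
Proof.
move=> /(_ 0)[M fM].
pose c := (p * gamma 0%N)^-1.
have c0 : 0 <= c.
  case: x_hippa => _ /(_ 0%N)/andP[g0 _] _.
  by rewrite invr_ge0 mulr_ge0// ltW// (lt_trans gmin_gt0).
(* Bounds the penalty of the first iteration at any [y] with [enorm y < M]. *)
pose B := c * (2 * (enorm (x 0%N) + M)) `^ p.
(* The value 0 serves outside the ball of radius [M], by the choice of [M]; inside it, minimality of
   [x 1] gives [f (x 1) <= f y + B]. *)
exists (Num.min 0 (fine (f (x 1%N)) - B)) => y Cy.
rewrite -(fineK (dom_fin_num _ Cy)) lee_fin ge_min.
have [My|yM] := leP M (enorm y).
  by have := fM y My; rewrite -(fineK (dom_fin_num _ Cy)) lee_fin => ->.
apply/orP; right.
have := hippa_min 0%N _ Cy; rewrite -/c.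
have : c * enorm (x 0%N - y) `^ p <= B.
  have x0 := enorm_ge0 (x 0%N); have y0 := enorm_ge0 y.
  have xy := enormB_le (x 0%N) y.
  by rewrite ler_wpM2l// ge0_ler_powR ?nnegrE ?enorm_ge0 ?(ltW p_gt0)//; lra.
have : 0 <= c * enorm (x 0%N - x 1%N) `^ p by rewrite mulr_ge0 ?powR_ge0.
lra.
Qed.

End Hippa.

Theorem theorem4p12 (R : realType) (n : nat)
    (f : 'rV[R]_n -> \bar R) (phi : R -> \bar R) (C : set 'rV[R]_n)
    (p gmin gmax : R) (gamma : nat -> R) (x : nat -> 'rV[R]_n)
    (f_notNy : forall y, f y <> -oo%E)
    (f_proper : proper_efun f)
    (f_lsc : lower_semicontinuous f)
    (f_coercive : coercive_efun f)
    (C_nonempty : C !=set0)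
    (C_closed : closed C)
    (C_convex : convex_set (C : set (convex_lmodType 'rV[R]_n)))
    (C_dom : C `<=` effective_dom f)
    (phi_modulus : modulus phi)
    (f_quasiconvex : uniformly_quasiconvex f phi C)
    (p_gt1 : 1 < p)
    (gmin_gt0 : 0 < gmin)
    (gmin_lt_gmax : gmin < gmax)
    (x_hippa : hippa f C p gmin gmax gamma x) :
  forall eps : R, 0 < eps ->
  exists k : nat,
    [/\ enorm (x k.+1 - x k) <= eps,
        forall j : nat, enorm (x j.+1 - x j) <= eps -> (k <= j)%N
      & (k%:R%:E <= (p * gmax)%:E * (f (x 0%N) - ereal_inf (f @` C))
                      / (eps `^ p)%:E)%E].
Proof.
move=> eps eps0.
have p0 : 0 < p by rewrite (lt_trans ltr01).
have pg0 : 0 < p * gmax by rewrite mulr_gt0// (lt_trans gmin_gt0).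
pose F k := fine (f (x k)).
pose d k := (p * gmax)^-1 * enorm (x k.+1 - x k) `^ p.
have descent k : F k.+1 + d k <= F k.
  exact (hippa_descent f_notNy C_dom p0 gmin_gt0 x_hippa k).
have e0 : 0 < (p * gmax)^-1 * eps `^ p by rewrite mulr_gt0 ?invr_gt0 ?powR_gt0.
have Fx k : f (x k) = (F k)%:E.
  by rewrite fineK// (dom_fin_num f_notNy C_dom)//; exact: (hippa_mem x_hippa).
have [m mf] : exists m : R, forall y, C y -> (m%:E <= f y)%E.
  exact: (hippa_lower_bounded f_notNy C_dom p0 gmin_gt0 x_hippa f_coercive).
(* Read contrapositively, a step longer than [eps] costs at least the threshold, since powers are
   monotone. *)
have step_le j : d j < (p * gmax)^-1 * eps `^ p -> enorm (x j.+1 - x j) <= eps.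
  apply: contraTT; rewrite -ltNge -leNgt => /ltW jeps.
  rewrite ler_wpM2l ?invr_ge0 ?(ltW pg0)//.
  by rewrite ge0_ler_powR ?nnegrE ?enorm_ge0 ?(ltW p0) ?(ltW eps0).
have /ex_minnP[k keps kmin] : exists k, enorm (x k.+1 - x k) <= eps.
  have [k|k dk] := descent_small_step descent m _ e0.
    by rewrite -lee_fin -Fx; apply: mf; exact: (hippa_mem x_hippa).
  by exists k; exact: step_le.
exists k; split=> //.
(* The infimum lies between [m] and [F k], so it is a real number [i] and the claim reduces to one
   over the reals. *)
have inf_le : (ereal_inf (f @` C) <= (F k)%:E)%E.
  rewrite -Fx; apply: ereal_inf_lbound; exists (x k) => //.
  exact: (hippa_mem x_hippa).
have : (m%:E <= ereal_inf (f @` C))%E.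
  by apply: le_ereal_inf_tmp => _ [y Cy <-]; exact: mf.
move: inf_le; rewrite Fx.
case: (ereal_inf _) => [i| |]//; rewrite lee_fin => ik _.
(* Minimality of [k] makes all [k] earlier steps longer than [eps]. *)
have count : k%:R * ((p * gmax)^-1 * eps `^ p) <= F 0%N - F k.
  apply: (descent_count descent) => j jk; rewrite leNgt; apply/negP.
  by move=> /step_le /kmin; rewrite leqNgt jk.
have epsp : 0 < eps `^ p by rewrite powR_gt0.
rewrite -EFinB -EFinM inver gt_eqF// -EFinM lee_fin ler_pdivlMr//.
(* It remains to replace [F k] by the smaller [i]. *)
by rewrite -ler_pdivrMl// mulrCA (le_trans count)// lerB.
Qed.
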